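(* Let $G$ be a finite group. If $G$ is an SST-group, then $G$ is an SC-group. Likewise, if $G$ is an NSST-group, then $G$ is an SC-group.
   Context: All groups are finite. Two subgroups $A,B$ of a group permute if $AB=BA$. A supplement of $H$ in $G$ is a subgroup $K\le G$ with $G=HK$. A subgroup $H$ of a group $G$ is SS-permutable in $G$ if $H$ has a supplement $K$ in $G$ such that $H$ permutes with every Sylow subgroup of $K$ (for all primes). $H$ is NSS-permutable in $G$ if $H$ has such a supplement $K$ which is moreover normal in $G$. $G$ is an SST-group (resp. NSST-group) if SS-permutability (resp. NSS-permutability) is a transitive relation on its subgroups: whenever $H\le K\le G$, $H$ is SS-permutable (resp. NSS-permutable) in $K$ and $K$ is SS-permutable (resp. NSS-permutable) in $G$, then $H$ is SS-permutable (resp. NSS-permutable) in $G$. A group is an SC-group if all its chief factors are simple groups. *)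

(* Defs.v *)
From mathcomp Require Import all_boot all_fingroup all_solvable.

Set Implicit Arguments.
Unset Strict Implicit.
Unset Printing Implicit Defensive.

Local Open Scope group_scope.

Definition permute (gT : finGroupType) (A B : {group gT}) : Prop :=
  A * B = B * A.

Definition supplement (gT : finGroupType) (G H K : {group gT}) : Prop :=
  K \subset G /\ H * K = G.

Definition permutes_with_Sylows (gT : finGroupType) (H K : {group gT}) : Prop :=
  forall (p : nat) (P : {group gT}), prime p -> p.-Sylow(K) P -> permute H P.

(* The ambient group G comes first: [SS_permutable G H] reads
   "H is SS-permutable in G", and includes H <= G. *)
Definition SS_permutable (gT : finGroupType) (G H : {group gT}) : Prop :=
  H \subset G /\
  exists K : {group gT}, supplement G H K /\ permutes_with_Sylows H K.

Definition NSS_permutable (gT : finGroupType) (G H : {group gT}) : Prop :=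
  H \subset G /\
  exists K : {group gT},
    [/\ supplement G H K, K <| G & permutes_with_Sylows H K].

Definition SST_group (gT : finGroupType) (G : {group gT}) : Prop :=
  forall H K : {group gT}, H \subset K -> K \subset G ->
    SS_permutable K H -> SS_permutable G K -> SS_permutable G H.

Definition NSST_group (gT : finGroupType) (G : {group gT}) : Prop :=
  forall H K : {group gT}, H \subset K -> K \subset G ->
    NSS_permutable K H -> NSS_permutable G K -> NSS_permutable G H.

(* [chief_factor G V U] says that U / V is a chief factor of G. *)
Definition SC_group (gT : finGroupType) (G : {group gT}) : Prop :=
  forall U V : {group gT}, chief_factor G V U -> simple (U / V).

(* Main.v *)
Require Import Defs.
From mathcomp Require Import all_boot all_fingroup all_solvable.

(** In an SST-group, and in an NSST-group, every subgroup [H] that is normal in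
    a normal subgroup of [G] is SS-permutable in [G]: a normal subgroup is
    (N)SS-permutable with the whole group as supplement, and transitivity
    composes the two steps.  This consequence is inherited by the quotients of
    [G], so it suffices to show that a minimal normal subgroup [N] of a group
    [G] is simple as soon as all its normal subgroups are SS-permutable in [G]
    ([minnormal_simple_pgroup] and [minnormal_simple_npgroup]).

    Suppose first that [N] is a [p]-group, hence abelian, and pick [H] of order
    [p] in [N] and central in a Sylow [p]-subgroup [P] of [G].  Let [K] be a
    supplement witnessing that [H] is SS-permutable.  Then [N :&: K] is normal
    in [G = N K], so it is trivial, and [N = H (N :&: K) = H]; or it is [N], and
    [K = G].  In the second case, if [Q] is a Sylow [q]-subgroup with [q != p],
    then [H = N :&: H Q] is normalised by [Q]; as [P] centralises [H], [H] is
    normal in [G], and again [N = H].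

    Suppose now that [N] is not of prime power order, and let [H] be a minimal
    normal subgroup of [N], with a supplement [K] as above.  If an element [x]
    of a Sylow [q]-subgroup [Q] of [K] did not normalise [H], then [H] and its
    conjugate [H :^ x] would generate their direct product inside [H Q], so
    that [#|H| ^ 2] would divide [#|H| * #|Q|].  Then [H] would be a nontrivial
    normal [q]-subgroup of [N], forcing the characteristic subgroup ['O_q(N)]
    to be [N].  Hence [K] normalises [H], so [H] is normal in [G = H K]; thus
    [H = N] and [N] is simple. *)

Set Implicit Arguments.
Unset Strict Implicit.
Unset Printing Implicit Defensive.

Local Open Scope group_scope.

Section Auxiliary.

Variable gT : finGroupType.
Implicit Types G H K M N P Q V : {group gT}.

(** A group is generated by any choice of one Sylow subgroup for each prime. *)
Lemma sub_of_Sylows K M :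
    (forall p, prime p -> exists2 P : {group gT}, p.-Sylow(K) P & P \subset M) ->
  K \subset M.
Proof.
move=> sylM; apply/setIidPl/eqP; rewrite eqEcard subsetIl /=.
apply: dvdn_leq; first exact: cardG_gt0.
apply/dvdn_partP=> // p; rewrite mem_primes => /and3P[p_pr _ _].
have [P sylP sPM] := sylM p p_pr.
by rewrite -(card_Hall sylP) cardSg // subsetI (pHall_sub sylP).
Qed.

Lemma minnormalP N G :
  reflect [/\ N :!=: 1, G \subset 'N(N) &
             forall M, M :!=: 1 -> G \subset 'N(M) -> M \subset N -> M :=: N]
          (minnormal N G).
Proof.
apply: (iffP mingroupP) => [[/andP[ntN nNG] minN] | [ntN nNG minN]].
  by split=> // M ntM nMG sMN; rewrite (minN M) // ntM.
split=> [|M /andP[ntM nMG] sMN]; first by rewrite ntN.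
exact: minN.
Qed.

Lemma prime_card_simple G : prime #|G| -> simple G.
Proof.
move=> G_pr; apply/simpleP; split=> [|M /andP[sMG _]].
  by apply: contraTneq G_pr => ->; rewrite cards1.
have [-> | ntM] := eqVneq (M : {set gT}) 1; [by left | right].
apply/eqP; rewrite eqEsubset sMG prime_meetG //.
by rewrite (setIidPr sMG).
Qed.

Lemma minnormal_char N G M : minnormal N G -> M \char N -> M :!=: 1 -> M :=: N.
Proof.
case/minnormalP=> _ nNG minN chM ntM; apply: minN => //.
  exact: char_norm_trans chM nNG.
exact: char_sub chM.
Qed.

Lemma NSS_permutable_SS G H : NSS_permutable G H -> SS_permutable G H.
Proof. by case=> sHG [K [supK _ permK]]; split=> //; exists K. Qed.

Lemma normal_NSS_permutable G H : H <| G -> NSS_permutable G H.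
Proof.
case/andP=> sHG nHG; split=> //; exists G; split=> //.
  by split; rewrite // mulSGid.
move=> p P _ sylP; rewrite /permute; apply: esym.
exact: normC (subset_trans (pHall_sub sylP) nHG).
Qed.

Lemma quotient_SS_permutable G V H :
  V <| G -> SS_permutable G H -> SS_permutable (G / V)%G (H / V)%G.
Proof.
case/andP=> _ nVG [sHG [K [[sKG defG] permK]]].
have nVH := subset_trans sHG nVG; have nVK := subset_trans sKG nVG.
split; first exact: quotientS.
exists (K / V)%G; split.
  by split; rewrite /= ?quotientS // -quotientMl // defG.
move=> p Pbar p_pr sylPbar; rewrite /permute /=.
have [P sylP] := Sylow_exists p K.
have sylPV := quotient_pHall (subset_trans (pHall_sub sylP) nVK) sylP.
have [_ /morphimP[x nVx Kx ->] ->] := Sylow_trans sylPV sylPbar.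
have sylPx : p.-Sylow(K) (P :^ x)%G by rewrite pHallJ.
have nVPx := subset_trans (pHall_sub sylPx) nVK.
rewrite /= -quotientJ // -quotientMl // -[RHS]quotientMl //.
by rewrite (permK p _ p_pr sylPx).
Qed.

(** The product [HQ] is a group normalised by [Q], and it meets [N] in
    [H (N :&: Q) = H]. *)
Lemma permute_coprime_norm N H Q (p : nat) :
    p.-group N -> H \subset N -> Q \subset 'N(N) -> p^'.-group Q ->
  permute H Q -> Q \subset 'N(H).
Proof.
move=> pN sHN nNQ p'Q cHQ.
have defHQ : H <*> Q = H * Q by rewrite comm_joingE.
have defH : H * Q :&: N = H.
  by rewrite -group_modl // setIC (coprime_TIg (pnat_coprime pN p'Q)) mulg1.
apply/subsetP=> x Qx; rewrite inE -{2}defH subsetI; apply/andP; split.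
  rewrite -defHQ; apply: conj_subG; last exact: joing_subl.
  exact: (subsetP (joing_subr _ _)).
by rewrite -(normsP nNQ x Qx) conjSg.
Qed.

(** If [Q] did not normalise [H], then [H] and a distinct conjugate [H :^ x]
    would generate their direct product inside the group [HQ]; hence [#|H| ^ 2]
    would divide [#|H| * #|Q|], and [H] would be a [q]-group. *)
Lemma permute_minnormal_norm N H Q (q : nat) :
    minnormal H N -> H \subset N -> Q \subset 'N(N) -> q.-group Q ->
  permute H Q -> ~~ q.-group H -> Q \subset 'N(H).
Proof.
move=> minHN sHN nNQ qQ cHQ; apply: contraR => /subsetPn[x Qx nHx].
have [_ nHN minH] := minnormalP _ _ minHN.
have nNx := subsetP nNQ x Qx.
have nHxN : N \subset 'N(H :^ x) by rewrite normJ -(normP nNx) conjSg.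
have tiHHx : H :&: H :^ x = 1.
  apply/eqP; apply: contraR nHx => ntI.
  have /setIidPl sHHx : H :&: (H :^ x)%G = H.
    by apply: minH; rewrite //= ?subsetIl // normsI.
  rewrite -groupV inE; apply/subsetP=> _ /imsetP[y Hy ->].
  by have := subsetP sHHx y Hy; rewrite mem_conjg.
have nHHx : H \subset 'N(H :^ x) by apply: subset_trans nHxN.
have defHQ : H <*> Q = H * Q by rewrite comm_joingE.
have sHHxQ : H <*> H :^ x \subset H <*> Q.
  rewrite join_subG joing_subl conj_subG ?joing_subl //.
  exact: (subsetP (joing_subr _ _)).
have: #|H| * #|H| %| #|H| * #|Q|.
  rewrite -[X in _ * X %| _](cardJg _ x) -(TI_cardMg tiHHx).
  rewrite -(norm_joinEl nHHx) mul_cardG -defHQ dvdn_mulr //.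
  exact: cardSg.
by rewrite dvdn_pmul2l ?cardG_gt0 // => /pnat_dvd; apply.
Qed.

End Auxiliary.

Section MinimalNormal.

Variables (gT : finGroupType) (G N : {group gT}).
Hypothesis minN : minnormal N G.
Hypothesis nsNG : N <| G.
Hypothesis SSN : forall H : {group gT}, H <| N -> SS_permutable G H.

Lemma minnormal_simple_pgroup (p : nat) : p.-group N -> simple N.
Proof.
move=> pN; have [ntN nNG minNG] := minnormalP _ _ minN.
have sNG := normal_sub nsNG; have [p_pr _ _] := pgroup_pdiv pN ntN.
have cNN : abelian N.
  apply/center_idP; apply: (minnormal_char minN); first exact: center_char.
  by rewrite /= -(setIidPr (center_sub N)) meet_center_nil ?(pgroup_nil pN).
have [P sylP] := Sylow_exists p G.
have sNP : N \subset P by apply: normal_sub_max_pgroup (Hall_max sylP) pN nsNG.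
have nsNP : N <| P := normalS sNP (pHall_sub sylP) nsNG.
have ntZ : N :&: 'Z(P) != 1.
  exact: meet_center_nil (pgroup_nil (pHall_pgroup sylP)) nsNP ntN.
have [_ p_dv_Z _] := pgroup_pdiv (pgroupS (subsetIl N 'Z(P)) pN) ntZ.
have [x /setIP[Nx Zx] ox] := Cauchy p_pr p_dv_Z.
have sHN : <[x]> \subset N by rewrite cycle_subG.
suffices defN : <[x]> = N.
  by apply: prime_card_simple; rewrite -defN [#|_|]ox.
have ntH : <[x]> != 1.
  by rewrite -cardG_gt1 [#|_|]ox prime_gt1.
have nsHN : <[x]> <| N by rewrite -sub_abelian_normal.
have [_ [K [[sKG defG] permK]]] := SSN nsHN.
have nNK := subset_trans sKG nNG.
have nIG : G \subset 'N(N :&: K).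
  rewrite -defG mul_subG //; last by rewrite normsI ?normG.
  apply: subset_trans sHN _; exact: sub_abelian_norm cNN (subsetIl _ _).
have [tiNK | ntNK] := eqVneq (N :&: K) 1.
  by rewrite -[RHS](setIidPl sNG) -defG setIC -group_modl // setIC tiNK mulg1.
have /setIidPl sNK : N :&: K = N by apply: (minNG (N :&: K)%G); rewrite ?subsetIl.
have defK : K :=: G by rewrite -defG mulSGid // (subset_trans sHN).
apply: (minNG <[x]>%G) => //=; apply: sub_of_Sylows => q q_pr.
have [-> | neq_qp] := eqVneq q p.
  exists P => //; apply: cents_norm; rewrite centsC cycle_subG.
  exact: subsetP (subsetIr P 'C(P)) x Zx.
have [Q sylQ] := Sylow_exists q G; exists Q => //.
apply: permute_coprime_norm pN sHN _ _ _.
- exact: subset_trans (pHall_sub sylQ) nNG.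
- apply: pi_pnat (pHall_pgroup sylQ) _.
  by rewrite !inE.
by apply: (permK q) => //; rewrite defK.
Qed.

Lemma minnormal_simple_npgroup : (forall q : nat, ~~ q.-group N) -> simple N.
Proof.
move=> npN; have [ntN nNG minNG] := minnormalP _ _ minN.
have [H minH sHN] := minnormal_exists ntN (normG N).
have [ntH nHN _] := minnormalP _ _ minH.
have nsHN : H <| N by apply/andP.
have npH (q : nat) : ~~ q.-group H.
  apply: contra (npN q) => qH.
  have ntO : 'O_q(N) != 1.
    by apply: subG1_contra (pcore_max qH nsHN) ntH.
  rewrite -(minnormal_char minN (pcore_char q N) ntO); exact: pcore_pgroup.
have [_ [K [[sKG defG] permK]]] := SSN nsHN.
have nHK : K \subset 'N(H).
  apply: sub_of_Sylows => q q_pr; have [Q sylQ] := Sylow_exists q K.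
  exists Q => //; apply: (permute_minnormal_norm minH sHN) (npH q).
  - exact: subset_trans (pHall_sub sylQ) (subset_trans sKG nNG).
  - exact: pHall_pgroup sylQ.
  exact: permK q_pr sylQ.
have defH : H :=: N by apply: minNG; rewrite // -defG mul_subG ?normG.
by move: minH; rewrite defH.
Qed.

Lemma minnormal_simple : simple N.
Proof.
have [pN | npN] := boolP ((pdiv #|N|).-group N).
  exact: minnormal_simple_pgroup pN.
apply: minnormal_simple_npgroup => q; apply: contra npN => qN.
have [ntN _ _] := minnormalP _ _ minN.
have [q_pr _ [m ->]] := pgroup_pdiv qN ntN.
by rewrite pdiv_pfactor.
Qed.

End MinimalNormal.

(** Transitivity enters only through subgroups of defect at most two. *)
Lemma SC_group_of_SS_permutable (gT : finGroupType) (G : {group gT}) :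
    (forall H U : {group gT}, H <| U -> U <| G -> SS_permutable G H) ->
  SC_group G.
Proof.
move=> SSG U V chUV; have minUV := chief_factor_minnormal chUV.
have /andP[/maxgroupp/andP[/andP[sVU _] nVG] nsUG] := chUV.
have nsVG : V <| G by rewrite /normal nVG (subset_trans sVU) ?normal_sub.
have nsVU : V <| U := normalS sVU (normal_sub nsUG) nsVG.
apply: (minnormal_simple minUV) => [|Hbar nsHbar].
  exact: quotient_normal.
have [H defH _ nsHU] := inv_quotientN nsVU nsHbar.
rewrite (group_inj (defH : Hbar :=: (H / V)%G)).
exact: quotient_SS_permutable nsVG (SSG H U nsHU nsUG).
Qed.

Theorem theorem1p4 (gT : finGroupType) (G : {group gT}) :
  (SST_group G -> SC_group G) /\ (NSST_group G -> SC_group G).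
Proof.
split=> trG; apply: SC_group_of_SS_permutable => H U nsHU nsUG.
  apply: (trG H U); rewrite ?normal_sub //.
    exact/NSS_permutable_SS/normal_NSS_permutable.
  exact/NSS_permutable_SS/normal_NSS_permutable.
apply: NSS_permutable_SS; apply: (trG H U); rewrite ?normal_sub //.
  exact: normal_NSS_permutable.
exact: normal_NSS_permutable.
Qed.
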